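(* Let $\mathcal{H}=\mathcal{V}\oplus\mathcal{W}^{\perp}$ and $\epsilon\ge0$. Let $(\mathbf{W},\mathbf{w})$ be a fusion frame for $\mathcal{W}$ and let $L\in\mathfrak{L}_{T_{\mathbf{W},\mathbf{w}}^{*},\epsilon}^{\mathcal{V},\mathcal{W}^{\perp}}$ be such that $V_i=LM_i\mathcal{K}_{\mathbf{W}}$ for each $i\in I$. Assume that $(\mathbf{V},\mathbf{v})$ is a fusion Bessel sequence for $\mathcal{V}$ and that $$Q_{L,\mathbf{v}}:\mathcal{K}_{\mathbf{W}}\to\mathcal{K}_{\mathbf{V}},\qquad Q_{L,\mathbf{v}}(f_j)_{j\in I}=\left(\tfrac{1}{v_i}LM_i(f_j)_{j\in I}\right)_{i\in I},$$ is a well defined bounded operator. Then $(\mathbf{V},\mathbf{v})$ is an $\epsilon$-approximate oblique component preserving $Q_{L,\mathbf{v}}$-dual fusion frame of $(\mathbf{W},\mathbf{w})$ on $\mathcal{V}$.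
   Context: $\mathcal{H}$ is a separable Hilbert space over $\mathbb{R}$ or $\mathbb{C}$, $\mathcal{V},\mathcal{W}$ are closed subspaces of $\mathcal{H}$, $I$ is a countable index set, and $B(\cdot,\cdot)$ denotes bounded linear operators. $\mathcal{H}=\mathcal{V}\oplus\mathcal{W}^{\perp}$ means a direct (not necessarily orthogonal) sum; $\pi_{\mathcal{V},\mathcal{W}^{\perp}}$ is the oblique projection with image $\mathcal{V}$ and kernel $\mathcal{W}^{\perp}$. $\mathbf{W}=\{W_i\}_{i\in I}$ is a family of closed subspaces of $\mathcal{W}$ and $\mathbf{w}=\{w_i\}_{i\in I}\in\ell^\infty(I)$ a family of weights, i.e. $w_i>0$ for all $i$. $\mathcal{K}_{\mathbf{W}}=\oplus_{i\in I}W_i$ is the Hilbert ($\ell^2$) direct sum. $(\mathbf{W},\mathbf{w})=\{(W_i,w_i)\}_{i\in I}$ is a fusion frame for $\mathcal{W}$ if there are $0<\alpha\le\beta<\infty$ with $\alpha\|f\|^2\le\sum_{i\in I}w_i^2\|\pi_{W_i}f\|^2\le\beta\|f\|^2$ for all $f\in\mathcal{W}$ ($\pi_{W_i}$ the orthogonal projection onto $W_i$); it is a fusion Bessel sequence for $\mathcal{W}$ if only the upper inequality is required. In that case the synthesis operator $T_{\mathbf{W},\mathbf{w}}:\mathcal{K}_{\mathbf{W}}\to\mathcal{H}$, $(f_i)_{i}\mapsto\sum_i w_if_i$, is bounded, with adjoint $T_{\mathbf{W},\mathbf{w}}^{*}f=(w_i\pi_{W_i}f)_{i}$. The same notation is used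 for $(\mathbf{V},\mathbf{v})$, $\mathbf{V}=\{V_i\}_{i\in I}$ closed subspaces of $\mathcal{V}$, $\mathbf{v}=\{v_i\}_{i\in I}\in\ell^\infty(I)$ weights. For $j\in I$, $M_j$ denotes the operator on $\mathcal{K}_{\mathbf{W}}$ (or $\mathcal{K}_{\mathbf{V}}$) which keeps the $j$-th component and replaces all the others by $0$. $Q\in B(\mathcal{K}_{\mathbf{W}},\mathcal{K}_{\mathbf{V}})$ is component preserving if $QM_j\mathcal{K}_{\mathbf{W}}=M_j\mathcal{K}_{\mathbf{V}}$ for each $j\in I$. A fusion frame $(\mathbf{V},\mathbf{v})$ for $\mathcal{V}$ is an $\epsilon$-approximate oblique $Q$-dual fusion frame of $(\mathbf{W},\mathbf{w})$ on $\mathcal{V}$ if $\|T_{\mathbf{V},\mathbf{v}}QT_{\mathbf{W},\mathbf{w}}^{*}-\pi_{\mathcal{V},\mathcal{W}^{\perp}}\|\le\epsilon$; it is an $\epsilon$-approximate oblique component preserving $Q$-dual fusion frame if moreover $Q$ is component preserving. $\mathfrak{L}_{T_{\mathbf{W},\mathbf{w}}^{*},\epsilon}^{\mathcal{V},\mathcal{W}^{\perp}}=\{U\in B(\mathcal{K}_{\mathbf{W}},\mathcal{H}):\|UT_{\mathbf{W},\mathbf{w}}^{*}-\pi_{\mathcal{V},\mathcal{W}^{\perp}}\|\le\epsilon\text{ and }\mathrm{Im}(U)=\mathcal{V}\}$. *)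

(* Defs.v *)
From HB Require Import structures.
From mathcomp Require Import all_boot all_order all_algebra finmap complex ring.
From mathcomp Require Import all_classical all_reals.
From mathcomp Require Import ereal topology normedtype esum.
From mathcomp Require summability.

Set Implicit Arguments.
Unset Strict Implicit.
Unset Printing Implicit Defensive.

Import Order.TTheory GRing.Theory Num.Theory.
Import numFieldNormedType.Exports.

Local Open Scope classical_set_scope.
Local Open Scope ring_scope.

(* The scalar field is R or C = R[i]. The norm of a mathcomp-analysis normed
   module takes its values in the scalars; sre brings it back to R. *)
Variant scalar_kind := RealScalars | ComplexScalars.

Definition scalars (R : realType) (k : scalar_kind) : numFieldType :=
  match k with RealScalars => R | ComplexScalars => R[i] end.

Section Scalars.
Context {R : realType} {k : scalar_kind}.
Local Notation K := (scalars R k).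

Definition sconj : K -> K :=
  match k with RealScalars => idfun | ComplexScalars => @conjc R end.

Definition sreal : R -> K :=
  match k with RealScalars => idfun | ComplexScalars => @real_complex R end.

Definition sre : K -> R :=
  match k with RealScalars => idfun | ComplexScalars => @complex.Re R end.

End Scalars.
Arguments sreal {R} k.

Section ScalarTheory.
Context {R : realType} {k : scalar_kind}.
Local Notation K := (scalars R k).

Lemma sconj_zmod_morphism : zmod_morphism (@sconj R k).
Proof. by case: k => x y //=; rewrite /sconj rmorphB. Qed.

Lemma sconj_monoid_morphism : monoid_morphism (@sconj R k).
Proof. by case: k; split => //; rewrite /sconj ?rmorph1// => x y; rewrite rmorphM. Qed.

HB.instance Definition _ :=
  GRing.isZmodMorphism.Build K K (@sconj R k) sconj_zmod_morphism.
HB.instance Definition _ :=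
  GRing.isMonoidMorphism.Build K K (@sconj R k) sconj_monoid_morphism.

Lemma sreal_zmod_morphism : zmod_morphism (@sreal R k).
Proof. by case: k => x y //=; rewrite /sreal rmorphB. Qed.

Lemma sreal_monoid_morphism : monoid_morphism (@sreal R k).
Proof. by case: k; split => //; rewrite /sreal ?rmorph1// => x y; rewrite rmorphM. Qed.

HB.instance Definition _ :=
  GRing.isZmodMorphism.Build R K (@sreal R k) sreal_zmod_morphism.
HB.instance Definition _ :=
  GRing.isMonoidMorphism.Build R K (@sreal R k) sreal_monoid_morphism.

Lemma sre_zmod_morphism : zmod_morphism (@sre R k).
Proof. by case: k => // x y; rewrite /sre raddfB. Qed.

HB.instance Definition _ :=
  GRing.isZmodMorphism.Build K R (@sre R k) sre_zmod_morphism.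

Lemma sconjK : involutive (@sconj R k).
Proof. by case: k => x; rewrite /sconj //= conjcK. Qed.

Lemma mul_sconj (x : K) : x * sconj x = `|x| ^+ 2.
Proof.
case: k x => x; rewrite /sconj/=; first by rewrite real_normK ?num_real.
exact/esym/normCK.
Qed.

Lemma norm_sconj (x : K) : `|sconj x| = `|x|.
Proof. by case: k x => x; rewrite /sconj//=; exact: norm_conjC. Qed.

Lemma srealK : cancel (@sreal R k) sre.
Proof. by case: k. Qed.

Lemma sreK (x : K) : 0 <= x -> sreal k (sre x) = x.
Proof.
case: k x => //= -[a b]; rewrite /sreal/sre/= lecE/= => /andP[/eqP-> _].
by [].
Qed.

Lemma ler_sreal (a b : R) : (sreal k a <= sreal k b) = (a <= b).
Proof. by case: k => //; rewrite /sreal/= lecR. Qed.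

Lemma ltr_sreal (a b : R) : (sreal k a < sreal k b) = (a < b).
Proof. by case: k => //; rewrite /sreal/= ltcR. Qed.

Lemma sconj_sreal (a : R) : sconj (sreal k a) = sreal k a.
Proof. by case: k => //=; rewrite /sconj/sreal/= oppr0. Qed.

Lemma norm_sreal (a : R) : `|sreal k a| = sreal k `|a|.
Proof. by case: k => //; rewrite /sreal /= normc_def/= expr0n/= addr0 sqrtr_sqr. Qed.

Lemma sre_ge0 (x : K) : 0 <= x -> 0 <= sre x.
Proof. by move=> x0; rewrite -ler_sreal sreK// rmorph0. Qed.

Lemma sre_le (x y : K) : x <= y -> sre x <= sre y.
Proof. by rewrite -subr_ge0 => /sre_ge0; rewrite raddfB subr_ge0. Qed.

Lemma sre_le_norm (x : K) : sre x <= sre `|x|.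
Proof.
case: k x => x; first exact: ler_norm.
rewrite /sre normc_def/=; apply: le_trans (ler_norm _) _.
by rewrite -sqrtr_sqr ler_wsqrtr// lerDl sqr_ge0.
Qed.

Lemma sreal_sreD (x : K) : x + sconj x = sreal k (sre x *+ 2).
Proof.
case: k x => [x|[a b]] /=; rewrite /sconj/sreal/sre/=; first by rewrite mulr2n.
by apply/eqP; rewrite eq_complex/= subrr mulr2n !eqxx.
Qed.

Lemma sreM_sreal (a : R) (x : K) : sre (sreal k a * x) = a * sre x.
Proof.
by case: k x => [x|[b c]] //=; rewrite /sreal/sre/= mul0r subr0.
Qed.

Lemma sreal_continuous : continuous (@sreal R k).
Proof.
move=> a; apply/cvgrPdist_le => e e0.
have e0' : 0 < sre e by rewrite -ltr_sreal rmorph0 sreK// ltW.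
apply/nbhs_normP; exists (sre e) => //= b.
by rewrite -rmorphB norm_sreal -[leRHS](sreK (ltW e0)) ler_sreal => /ltW.
Qed.

Lemma sconj_continuous : continuous (@sconj R k).
Proof.
move=> a; apply/(@cvgrPdist_le _ _ _ (nbhs a) (nbhs_filter a)) => e e0.
apply/nbhs_normP; exists e => //= b.
by rewrite -rmorphB norm_sconj => /ltW.
Qed.

End ScalarTheory.
Local Notation partial_sum := summability.partial_sum.
Local Notation totally := summability.totally.

#[global] Existing Instance summability.totally_filter.

Section UnconditionalSums.
Context {I : choiceType}.

Lemma partial_sumE (V : zmodType) (x : I -> V) (A : {fset I}) :
  partial_sum x A = \sum_(i <- A) x i.
Proof. by rewrite /partial_sum big_seq_fsetE. Qed.

Lemma partial_sumD (V : zmodType) (x y : I -> V) :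
  partial_sum (fun i => x i + y i) = partial_sum x \+ partial_sum y.
Proof. by apply/funext => A; rewrite /= !partial_sumE big_split. Qed.

Lemma partial_sumB (V : zmodType) (x y : I -> V) :
  partial_sum (fun i => x i - y i) = partial_sum x \- partial_sum y.
Proof. by apply/funext => A; rewrite /= !partial_sumE sumrB. Qed.

Lemma partial_sum_morph (U V : zmodType) (f : {additive U -> V}) (x : I -> U) :
  partial_sum (fun i => f (x i)) = f \o partial_sum x.
Proof. by apply/funext => A; rewrite /= !partial_sumE raddf_sum. Qed.

Lemma le_partial_sum (R : realType) (y : I -> R) (A B : {fset I}) :
  (forall i, 0 <= y i) -> (A `<=` B)%fset -> partial_sum y A <= partial_sum y B.
Proof.
move=> y0 AB; rewrite !partial_sumE [leRHS](bigID (fun i => i \in A))/=.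
rewrite [X in X + _](_ : _ = \sum_(i <- A) y i) ?lerDl ?sumr_ge0//.
rewrite -[LHS]big_filter; apply: perm_big; apply: uniq_perm.
- exact/filter_uniq/fset_uniq.
- exact: fset_uniq.
- move=> i; rewrite mem_filter; apply/andb_idr; exact: (fsubsetP AB).
Qed.

Lemma cvg_partial_sum_ge0 (R : realType) (y : I -> R) (M : R) :
  (forall i, 0 <= y i) -> (forall A, partial_sum y A <= M) ->
  partial_sum y @ totally --> sup (range (partial_sum y)).
Proof.
move=> y0 yM; set s := sup _.
have hs : has_sup (range (partial_sum y)).
  split; first by exists (partial_sum y fset0); exists fset0.
  by exists M => _ [A _ <-].
apply/cvgrPdist_le => e e0.
have [_ [A0 _ <-] sA0] := sup_adherent e0 hs.
exists A0 => //= A A0A.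
have As : partial_sum y A <= s by apply: ub_le_sup; [case: hs|exists A].
rewrite ger0_norm ?subr_ge0// lerBlDr -lerBlDl (le_trans (ltW sA0))//.
exact: le_partial_sum.
Qed.

Lemma cvg_partial_sum_real (R : realType) (y : I -> R) (M : R) :
  (forall A, partial_sum (fun i => `|y i|) A <= M) ->
  cvg (partial_sum y @ totally).
Proof.
move=> yM.
rewrite (_ : y = fun i => (y i + `|y i|) - `|y i|); last first.
  by apply/funext => i; rewrite addrK.
rewrite partial_sumB; apply: is_cvgB; apply/cvg_ex.
  exists (sup (range (partial_sum (fun i => y i + `|y i|)))).
  apply: (@cvg_partial_sum_ge0 _ _ (M + M)) => [i|A].
    by have := ler_norm (- y i); rewrite normrN -subr_ge0 opprK addrC.
  rewrite partial_sumD/= lerD//; apply: le_trans (yM A).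
  by rewrite !partial_sumE ler_sum// => i _; rewrite ler_norm.
exists (sup (range (partial_sum (fun i => `|y i|)))).
exact: (@cvg_partial_sum_ge0 _ _ M).
Qed.

Section scalars.
Context {R : realType} {k : scalar_kind}.
Local Notation K := (scalars R k).

Lemma cvg_partial_sum (x : I -> K) (M : R) :
  (forall A, partial_sum (fun i => sre `|x i|) A <= M) ->
  cvg (partial_sum x @ totally).
Proof.
case: k x => x xM; first exact: cvg_partial_sum_real xM.
have bnd (f : {additive scalars R ComplexScalars -> R}) :
    (forall z, `|f z| <= sre `|z|) -> cvg (partial_sum (f \o x) @ totally).
  move=> fle; apply: (@cvg_partial_sum_real _ _ M) => A.
  apply: le_trans (xM A); rewrite !partial_sumE; apply: ler_sum => i _.
  exact: fle.
have cre : cvg (partial_sum (@complex.Re R \o x) @ totally).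
  apply: (bnd (@complex.Re R)) => z.
  by have := @sre_le R ComplexScalars _ _ (normc_ge_Re z).
have cim : cvg (partial_sum (@complex.Im R \o x) @ totally).
  apply: (bnd (@complex.Im R)) => z.
  apply: (@sre_le R ComplexScalars (sreal ComplexScalars `|complex.Im z|)).
  case: z => a b; rewrite /sreal normc_def/= lecR.
  by rewrite -sqrtr_sqr ler_wsqrtr// lerDr sqr_ge0.
have cs (y : I -> R) : cvg (partial_sum y @ totally) ->
    cvg (sreal ComplexScalars \o partial_sum y @ totally).
  move=> cy; apply/cvg_ex; exists (sreal ComplexScalars (lim (partial_sum y @ totally))).
  by apply: continuous_cvg => //; exact: sreal_continuous.
rewrite (_ : partial_sum x = (sreal ComplexScalars \o partial_sum (@complex.Re R \o x)) \+
   (fun A => ('i%C : scalars R ComplexScalars) * (sreal ComplexScalars \o partial_sum (@complex.Im R \o x)) A)).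
  apply: is_cvgD; first exact: cs.
  by apply: is_cvgMl_tmp; apply: cs.
apply/funext => A /=.
rewrite !partial_sumE !(raddf_sum (@sreal R ComplexScalars)) big_distrr/= -big_split/=.
apply: eq_bigr => i _; exact: complexE.
Qed.

End scalars.
End UnconditionalSums.
Section DotForms.
Context {R : realType} {k : scalar_kind}.
Local Notation K := (scalars R k).
Variables (U : lmodType K) (form : {dot U for @sconj R k}).
Implicit Types (x y : U) (a : K).

Lemma form_ge0 x : 0 <= form x x.
Proof.
have [->|x0] := eqVneq x 0; first by rewrite linear0l.
exact/ltW/neq0_dnorm_gt0.
Qed.

Lemma formC x y : form x y = sconj (form y x).
Proof. by rewrite (hermC form) expr0 mul1r. Qed.

Lemma formDl x y z : form (x + y) z = form x z + form y z.
Proof. exact: linearDl. Qed.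

Lemma formDr x y z : form z (x + y) = form z x + form z y.
Proof. exact: linearDr. Qed.

Lemma formNl x y : form (- x) y = - form x y.
Proof. exact: linearNl. Qed.

Lemma formNr x y : form x (- y) = - form x y.
Proof. exact: linearNr. Qed.

Lemma formZl a x y : form (a *: x) y = a * form x y.
Proof. exact: linearZl_LR. Qed.

Lemma formZr a x y : form x (a *: y) = sconj a * form x y.
Proof. exact: linearZr_LR. Qed.

Lemma form_le_sum x y :
  sre `|form x y| *+ 2 <= sre (form x x) + sre (form y y).
Proof.
have [d0|d0] := eqVneq (form x y) 0.
  by rewrite d0 normr0 raddf0 mul0rn addr_ge0 ?sre_ge0 ?form_ge0.
pose d := form x y; pose u := d / `|d|.
have nd0 : `|d| != 0 by rewrite normr_eq0.
have rd : sconj `|d| = `|d| by rewrite -(sreK (normr_ge0 d)) sconj_sreal.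
have uu : u * sconj u = 1.
  by rewrite mul_sconj normrM normfV normr_id divff ?expr1n.
have xu : form x (u *: y) = `|d|.
  rewrite formZr rmorphM fmorphV/= rd -/d mulrAC [sconj d * d]mulrC mul_sconj.
  by rewrite expr2 mulfK.
have := form_ge0 (x - u *: y).
rewrite formDl !formDr !formNl !formNr opprK (formC (u *: y)) xu rd.
rewrite formZl formZr mulrA uu mul1r.
rewrite (_ : _ + _ = form x x + form y y - `|d| *+ 2); last first.
  by rewrite mulr2n opprD !addrA; rewrite addrAC [in RHS]addrAC.
by rewrite subr_ge0 => /sre_le; rewrite (raddfMn sre) raddfD.
Qed.

Definition dotnorm x : R := Num.sqrt (sre (form x x)).

Lemma dotnorm_ge0 x : 0 <= dotnorm x. Proof. exact: sqrtr_ge0. Qed.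

Lemma dotnorm_sqr x : dotnorm x ^+ 2 = sre (form x x).
Proof. by rewrite sqr_sqrtr// sre_ge0 ?form_ge0. Qed.

Lemma sreal_dotnorm_sqr x : sreal k (dotnorm x) ^+ 2 = form x x.
Proof. by rewrite -rmorphXn/= dotnorm_sqr sreK ?form_ge0. Qed.

Lemma dotnorm_eq0 x : dotnorm x = 0 -> x = 0.
Proof.
move=> x0; apply/eqP/negPn/negP => /(neq0_dnorm_gt0 (s := form)).
by rewrite -sreal_dotnorm_sqr x0 rmorph0 expr0n/= ltxx.
Qed.

Lemma dotnormZ a x : dotnorm (a *: x) = sre `|a| * dotnorm x.
Proof.
rewrite /dotnorm formZl formZr mulrA mul_sconj -(sreK (normr_ge0 a)) -rmorphXn/=.
by rewrite sreM_sreal sqrtrM ?sqr_ge0// sqrtr_sqr srealK ger0_norm ?sre_ge0.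
Qed.

Lemma CauchySchwarz_dotnorm x y : sre `|form x y| <= dotnorm x * dotnorm y.
Proof.
have [/eqP/dotnorm_eq0->|x0] := boolP (dotnorm x == 0).
  by rewrite linear0l normr0 raddf0 mulr_ge0 ?dotnorm_ge0.
have [/eqP/dotnorm_eq0->|y0] := boolP (dotnorm y == 0).
  by rewrite linear0r normr0 raddf0 mulr_ge0 ?dotnorm_ge0.
have nV z : `|(dotnorm z)^-1| = (dotnorm z)^-1.
  by rewrite ger0_norm// invr_ge0 dotnorm_ge0.
have := form_le_sum (sreal k ((dotnorm x)^-1) *: x) (sreal k ((dotnorm y)^-1) *: y).
rewrite -!dotnorm_sqr !dotnormZ !norm_sreal !srealK.
rewrite !nV !mulVf// expr1n.
rewrite formZl formZr sconj_sreal !normrM !norm_sreal !sreM_sreal.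
rewrite !nV.
rewrite -mulr2n lerMn2r/= ler_pdivrMl ?lt_neqAle ?dotnorm_ge0 1?eq_sym ?x0//.
by rewrite mulr1 ler_pdivrMl ?lt_neqAle ?dotnorm_ge0 1?eq_sym ?y0// mulrC.
Qed.

Lemma ler_dotnormD x y : dotnorm (x + y) <= dotnorm x + dotnorm y.
Proof.
rewrite -(@ler_pXn2r _ 2) ?nnegrE ?addr_ge0 ?dotnorm_ge0//.
rewrite dotnorm_sqr formDl !formDr (formC y x) sqrrD !dotnorm_sqr.
rewrite (_ : _ + _ = form x x + (form x y + sconj (form x y)) + form y y);
  last by rewrite !addrA.
rewrite sreal_sreD 2!raddfD/= srealK lerD2r lerD2l lerMn2r/=.
exact: le_trans (sre_le_norm _) (CauchySchwarz_dotnorm x y).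
Qed.

End DotForms.

HB.mixin Record NormedModule_isPreHilbert (R : realType) (k : scalar_kind) H
    & NormedModule (scalars R k) H := {
  (* linear in the first argument *)
  inner : {dot H for @sconj R k};
  inner_norm : forall x : H, inner x x = `|x| ^+ 2
}.

#[short(type="preHilbertType")]
HB.structure Definition PreHilbert (R : realType) (k : scalar_kind) :=
  { H of NormedModule (scalars R k) H & NormedModule_isPreHilbert R k H }.

#[short(type="hilbertType")]
HB.structure Definition Hilbert (R : realType) (k : scalar_kind) :=
  { H of PreHilbert R k H & Complete H }.

Definition separable_space (T : topologicalType) :=
  exists2 D : set T, countable D & dense D.

Definition rnorm (R : realType) (k : scalar_kind)
  (V : normedModType (scalars R k)) (x : V) : R := sre `|x|.

Record closedSubspace (R : realType) (k : scalar_kind)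
    (H : normedModType (scalars R k)) := ClosedSubspace {
  subspace_set :> set H ;
  subspace0 : subspace_set 0 ;
  subspaceP : forall a x y,
    subspace_set x -> subspace_set y -> subspace_set (a *: x + y) ;
  subspace_closed : closed subspace_set
}.

Section Operators.
Context {R : realType} {k : scalar_kind}.

(* Extended-real valued, so that an unbounded map has norm +oo. *)
Definition opnorm (E F : normedModType (scalars R k)) (T : E -> F) : \bar R :=
  ereal_sup [set (rnorm (T x))%:E | x in [set x : E | rnorm x <= 1]].

Definition bounded_operator (E F : normedModType (scalars R k))
  (T : {linear E -> F}) := bounded_near T (nbhs 0).

(* The default value 0 is only taken when T has no adjoint. *)
Definition adjoint (E F : preHilbertType R k) (T : E -> F) (y : F) : E :=
  xget 0 [set x | forall z, inner (T z) y = inner z x].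

End Operators.

Section Projections.
Context {R : realType} {k : scalar_kind} {H : preHilbertType R k}.
Implicit Types (S T : set H).

Definition orthogonal_complement S : set H :=
  [set f | forall g, S g -> inner f g = 0].

Definition direct_sum S T :=
  S `&` T = [set 0] /\ forall f, exists a b, [/\ S a, T b & f = a + b].

(* The projection with image S and kernel T, when H is their direct sum. *)
Definition oblique_projection S T (f : H) : H :=
  xget 0 [set a | S a /\ T (f - a)].

Definition orthogonal_projection S : H -> H :=
  oblique_projection S (orthogonal_complement S).

Definition approximate_left_inverses (E : normedModType (scalars R k))
    (A : H -> E) (eps : R) S T : set {linear E -> H} :=
  [set U : {linear E -> H} | [/\
     (opnorm ((U \o A) \- oblique_projection S T)%R <= eps%:E)%E,
     bounded_operator U & range U = S]].

End Projections.

Section HilbertSum.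
Context {R : realType} {k : scalar_kind} {H : hilbertType R k} {I : choiceType}.
Local Notation K := (scalars R k).
Variable S : I -> closedSubspace H.

Definition l2_families : {pred I -> H} := fun f =>
  `[< (forall i, subspace_set (S i) (f i)) /\
      (\esum_(i in [set: I]) (rnorm (f i) ^+ 2)%:E < +oo)%E >].

Record hilbert_sum := HilbertSum {
  family_of :> I -> H ;
  family_ofP : family_of \in l2_families
}.

HB.instance Definition _ := [isSub for family_of].
HB.instance Definition _ := [Choice of hilbert_sum by <:].

Lemma fsbig_partial_sum (a : I -> R) (A : {fset I}) :
  (\sum_(i \in [set` A]) (a i)%:E)%E = (partial_sum a A)%:E.
Proof. by rewrite partial_sumE -sumEFin fsbig_finite//= set_fsetK. Qed.

Lemma esum_boundP (a : I -> R) : (forall i, 0 <= a i) ->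
  (\esum_(i in [set: I]) (a i)%:E < +oo)%E <->
  exists M, forall A : {fset I}, partial_sum a A <= M.
Proof.
move=> a0; split=> [afin|[M aM]].
  exists (fine (\esum_(i in [set: I]) (a i)%:E)) => A.
  rewrite -lee_fin fineK; last first.
    by rewrite ge0_fin_numE// esum_ge0// => i _; rewrite lee_fin.
  rewrite -fsbig_partial_sum; apply: ereal_sup_ubound; exists [set` A] => //.
apply: (@le_lt_trans _ _ M%:E); last exact: ltry.
apply: ge_ereal_sup => _ [A [finA _] <-].
by rewrite -(fset_setK finA) fsbig_partial_sum lee_fin.
Qed.

Lemma rnorm_sqrE (x : H) : rnorm x ^+ 2 = sre (inner x x).
Proof.
rewrite inner_norm -[in RHS](sreK (normr_ge0 x)) -rmorphXn/= srealK.
by [].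
Qed.

Lemma rnorm_dotnorm (x : H) : rnorm x = dotnorm inner x.
Proof.
by rewrite /dotnorm -rnorm_sqrE sqrtr_sqr ger0_norm// sre_ge0.
Qed.

Lemma l2_familiesP (f : I -> H) : f \in l2_families <->
  (forall i, subspace_set (S i) (f i)) /\
  exists M, forall A : {fset I}, partial_sum (fun i => rnorm (f i) ^+ 2) A <= M.
Proof.
split=> [/asboolP[Sf]|[Sf fM]].
  by move=> /esum_boundP fM; split => //; apply: fM => i; exact: sqr_ge0.
by apply/asboolP; split=> //; apply/esum_boundP => // i; exact: sqr_ge0.
Qed.

Lemma l2_families_submod : GRing.submod_closed l2_families.
Proof.
split=> [|a f g /l2_familiesP[Sf [M fM]] /l2_familiesP[Sg [N gN]]].
  apply/l2_familiesP; split=> [i|]; first exact: subspace0.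
  exists 0 => A; rewrite partial_sumE big1// => i _.
  by rewrite /rnorm normr0 raddf0 expr0n.
apply/l2_familiesP; split=> [i|]; first exact: subspaceP.
exists ((sre `|a| ^+ 2 * M + N) *+ 2) => A.
have h i : rnorm ((a *: f + g) i) ^+ 2 <=
    (sre `|a| ^+ 2 * rnorm (f i) ^+ 2 + rnorm (g i) ^+ 2) *+ 2.
  rewrite !rnorm_dotnorm; have := ler_dotnormD inner (a *: f i) (g i).
  rewrite dotnormZ => /(lerXn2r 2) h; apply: le_trans (h _ _) _.
  - by rewrite nnegrE dotnorm_ge0.
  - by rewrite nnegrE addr_ge0// ?mulr_ge0 ?sre_ge0 ?dotnorm_ge0.
  by rewrite -exprMn; set u := _ * _; set v := dotnorm _ _;
     rewrite -subr_ge0 [X in 0 <= X](_ : _ = (u - v) ^+ 2) ?sqr_ge0//; ring.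
rewrite partial_sumE; apply: (le_trans (ler_sum _ (fun i _ => h i))).
rewrite sumrMnl big_split/= -mulr_sumr lerMn2r/= lerD//.
  by rewrite ler_wpM2l ?sqr_ge0// -partial_sumE.
by rewrite -partial_sumE.
Qed.

HB.instance Definition _ :=
  GRing.isSubmodClosed.Build K (I -> H) l2_families l2_families_submod.
HB.instance Definition _ := [SubChoice_isSubLmodule of hilbert_sum by <:].

(* Unconditional sum: limit of the finite partial sums along the net of finite
   subsets of I. *)
Definition hilbert_sum_inner (f g : hilbert_sum) : K :=
  summability.sum (fun i => inner (f i) (g i)).

Lemma is_cvg_inner (f g : hilbert_sum) :
  cvg (partial_sum (fun i => inner (f i) (g i)) @ totally).
Proof.
have /l2_familiesP[_ [M fM]] := family_ofP f.
have /l2_familiesP[_ [N gN]] := family_ofP g.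
apply: (@cvg_partial_sum _ _ _ _ (M + N)) => A.
apply: le_trans (lerD (fM A) (gN A)).
rewrite !partial_sumE -big_split/=; apply: ler_sum => i _.
rewrite !rnorm_sqrE; apply: le_trans (form_le_sum inner _ _).
by rewrite mulr2n lerDl sre_ge0.
Qed.

Lemma cvg_inner (f g : hilbert_sum) :
  partial_sum (fun i => inner (f i) (g i)) @ totally -->
  hilbert_sum_inner f g.
Proof. exact: is_cvg_inner. Qed.

Lemma inner_unique (f g : hilbert_sum) (l : K) :
  partial_sum (fun i => inner (f i) (g i)) @ totally --> l ->
  hilbert_sum_inner f g = l.
Proof. by move=> fl; apply: cvg_lim => //; exact: norm_hausdorff. Qed.

Lemma hilbert_sum_innerPl (a : K) (f g h : hilbert_sum) :
  hilbert_sum_inner (a *: f + g) h =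
  a * hilbert_sum_inner f h + hilbert_sum_inner g h.
Proof.
apply: inner_unique.
rewrite (_ : partial_sum _ = (fun A =>
   a * partial_sum (fun i => inner (f i) (h i)) A +
   partial_sum (fun i => inner (g i) (h i)) A)); last first.
  apply/funext => A; rewrite !partial_sumE mulr_sumr -big_split/=.
  by apply: eq_bigr => i _; rewrite formDl formZl.
by apply: cvgD; [apply: cvgMl_tmp|]; exact: cvg_inner.
Qed.

Lemma hilbert_sum_innerC (f g : hilbert_sum) :
  hilbert_sum_inner f g = sconj (hilbert_sum_inner g f).
Proof.
apply: inner_unique.
rewrite (_ : partial_sum _ = (fun A =>
   sconj (partial_sum (fun i => inner (g i) (f i)) A))); last first.
  apply/funext => A; rewrite !partial_sumE rmorph_sum/=.
  by apply: eq_bigr => i _; rewrite formC.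
apply: continuous_cvg; first exact: sconj_continuous.
exact: cvg_inner.
Qed.

Lemma hilbert_sum_bilinear :
  bilinear_for *%R (@sconj R k \; *%R) hilbert_sum_inner.
Proof.
split=> h a f g /=; first exact: hilbert_sum_innerPl.
rewrite hilbert_sum_innerC hilbert_sum_innerPl rmorphD rmorphM/=.
by rewrite -!hilbert_sum_innerC.
Qed.

HB.instance Definition _ := bilinear_isBilinear.Build K hilbert_sum hilbert_sum
  K ( *%R ) (@sconj R k \; *%R) hilbert_sum_inner hilbert_sum_bilinear.

Lemma hilbert_sum_hermitian (f g : hilbert_sum) :
  hilbert_sum_inner f g = (-1) ^+ false * sconj (hilbert_sum_inner g f).
Proof. by rewrite expr0 mul1r -hilbert_sum_innerC. Qed.

HB.instance Definition _ := isHermitianSesquilinear.Build K hilbert_sum false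
  (@sconj R k) hilbert_sum_inner hilbert_sum_hermitian.

Lemma hilbert_sum_innerE (f : hilbert_sum) : hilbert_sum_inner f f =
  sreal k (sup (range (partial_sum (fun i => rnorm (f i) ^+ 2)))).
Proof.
have /l2_familiesP[_ [M fM]] := family_ofP f.
apply: inner_unique.
rewrite (_ : partial_sum _ =
  (fun A => sreal k (partial_sum (fun i => rnorm (f i) ^+ 2) A))); last first.
  apply/funext => A; rewrite !partial_sumE rmorph_sum/=.
  by apply: eq_bigr => i _; rewrite rnorm_sqrE sreK// form_ge0.
apply: continuous_cvg; first exact: sreal_continuous.
by apply: (cvg_partial_sum_ge0 _ fM) => i; exact: sqr_ge0.
Qed.

Lemma hilbert_sum_definite (f : hilbert_sum) :
  f != 0 -> 0 < hilbert_sum_inner f f.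
Proof.
have /l2_familiesP[_ [M fM]] := family_ofP f.
move=> f0; have [i fi0] : exists i, f i != 0.
  apply: contrapT => /forallNP fE; case/eqP: f0; apply/val_inj/funext => i /=.
  by apply/eqP/negPn/negP/fE.
rewrite hilbert_sum_innerE -[ltLHS](rmorph0 (@sreal R k)) ltr_sreal.
apply: (@lt_le_trans _ _ (rnorm (f i) ^+ 2)).
  rewrite exprn_gt0// rnorm_dotnorm lt_neqAle dotnorm_ge0 andbT eq_sym.
  by apply: contraNneq fi0 => /dotnorm_eq0 ->.
apply: ub_le_sup; first by exists M => _ [A _ <-].
by exists [fset i]%fset => //; rewrite partial_sumE big_seq_fset1.
Qed.

HB.instance Definition _ := isDotProduct.Build K hilbert_sum
  hilbert_sum_inner hilbert_sum_definite.

Definition hilbert_sum_norm (f : hilbert_sum) : K :=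
  sreal k (dotnorm hilbert_sum_inner f).

Lemma hilbert_sum_ler_normD (f g : hilbert_sum) :
  hilbert_sum_norm (f + g) <= hilbert_sum_norm f + hilbert_sum_norm g.
Proof. by rewrite -rmorphD/= ler_sreal ler_dotnormD. Qed.

Lemma hilbert_sum_normZ (a : K) (f : hilbert_sum) :
  hilbert_sum_norm (a *: f) = `|a| * hilbert_sum_norm f.
Proof. by rewrite /hilbert_sum_norm dotnormZ rmorphM/= sreK. Qed.

Lemma hilbert_sum_norm0_eq0 (f : hilbert_sum) :
  hilbert_sum_norm f = 0 -> f = 0.
Proof.
move=> /(congr1 sre); rewrite srealK raddf0; exact: dotnorm_eq0.
Qed.

HB.instance Definition _ := Lmodule_isNormed.Build K hilbert_sum
  hilbert_sum_ler_normD hilbert_sum_normZ hilbert_sum_norm0_eq0.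

Lemma hilbert_sum_inner_norm (f : hilbert_sum) :
  hilbert_sum_inner f f = `|f| ^+ 2.
Proof. by rewrite -[ `|f| ]/(hilbert_sum_norm f) sreal_dotnorm_sqr. Qed.

HB.instance Definition _ :=
  NormedModule_isPreHilbert.Build R k hilbert_sum hilbert_sum_inner_norm.

Lemma rnorm_hilbert_sum (f : hilbert_sum) :
  ((rnorm f ^+ 2)%:E = \esum_(i in [set: I]) (rnorm (f i) ^+ 2)%:E)%E.
Proof.
have /asboolP[_ ffin] := family_ofP f.
have /l2_familiesP[_ [M fM]] := family_ofP f.
have f0 i : 0 <= rnorm (f i) ^+ 2 by exact: sqr_ge0.
have fin : (\esum_(i in [set: I]) (rnorm (f i) ^+ 2)%:E)%E \is a fin_num.
  by rewrite ge0_fin_numE// esum_ge0// => i _; rewrite lee_fin.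
rewrite /rnorm -[ `|f| ]/(hilbert_sum_norm f) srealK dotnorm_sqr/= hilbert_sum_innerE srealK.
apply/eqP; rewrite eq_le; apply/andP; split.
  rewrite -(fineK fin) lee_fin; apply: ge_sup.
    by exists (partial_sum (fun i => rnorm (f i) ^+ 2) fset0); exists fset0.
  move=> _ [A _ <-]; rewrite -lee_fin fineK// -fsbig_partial_sum.
  by apply: ereal_sup_ubound; exists [set` A].
apply: ge_ereal_sup => _ [A [finA _] <-].
rewrite -(fset_setK finA) fsbig_partial_sum lee_fin; apply: ub_le_sup.
  by exists M => _ [B _ <-].
by exists (fset_set A).
Qed.

Lemma component_subproof (j : I) (f : hilbert_sum) :
  (fun i => if i == j then f i else 0) \in l2_families.
Proof.
have /l2_familiesP[Sf [M fM]] := family_ofP f.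
apply/l2_familiesP; split=> [i|]; first by case: ifP => _ //; exact: subspace0.
exists M => A; apply: le_trans (fM A); rewrite !partial_sumE ler_sum// => i _.
by case: ifP => // _; rewrite /rnorm normr0 raddf0 expr0n sqr_ge0.
Qed.

Definition component (j : I) (f : hilbert_sum) : hilbert_sum :=
  HilbertSum (component_subproof j f).

End HilbertSum.

Section FusionFrames.
Context {R : realType} {k : scalar_kind} {H : hilbertType R k} {I : countType}.
Implicit Types (V W : closedSubspace H) (Vs Ws : I -> closedSubspace H).
Implicit Types (v w : I -> R).

(* Positive bounded families. *)
Definition weights w := (forall i, 0 < w i) /\ exists M, forall i, w i <= M.

Definition frame_sum Ws w (f : H) : \bar R :=
  \esum_(i in [set: I])
    (w i ^+ 2 * rnorm (orthogonal_projection (Ws i) f) ^+ 2)%:E.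

Definition fusion_bessel W Ws w :=
  [/\ forall i, Ws i `<=` W,
      weights w &
      exists2 beta : R, 0 < beta & forall f, subspace_set W f ->
        (frame_sum Ws w f <= (beta * rnorm f ^+ 2)%:E)%E].

Definition fusion_frame W Ws w :=
  [/\ forall i, Ws i `<=` W,
      weights w &
      exists alpha beta : R, [/\ 0 < alpha, alpha <= beta &
        forall f, subspace_set W f ->
          ((alpha * rnorm f ^+ 2)%:E <= frame_sum Ws w f
             <= (beta * rnorm f ^+ 2)%:E)%E]].

Definition synthesis Ws w (f : hilbert_sum Ws) : H :=
  summability.sum (fun i => sreal k (w i) *: f i).

Definition component_preserving Ws Vs
    (Q : {linear hilbert_sum Ws -> hilbert_sum Vs}) :=
  forall j, [set Q (component j f) | f in setT] =
            [set component j g | g in setT].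

Definition approximate_oblique_dual (eps : R) V W Ws w Vs v
    (Q : {linear hilbert_sum Ws -> hilbert_sum Vs}) :=
  [/\ fusion_frame V Vs v,
      bounded_operator Q &
      (opnorm ((@synthesis Vs v \o Q \o adjoint (@synthesis Ws w))
        \- oblique_projection V (orthogonal_complement W))%R <= eps%:E)%E].

Definition approximate_oblique_component_preserving_dual (eps : R) V W Ws w Vs v
    (Q : {linear hilbert_sum Ws -> hilbert_sum Vs}) :=
  approximate_oblique_dual eps V W w v Q /\ component_preserving Q.

End FusionFrames.
Arguments synthesis {R k H I} Ws w f.
Arguments approximate_oblique_dual {R k H I} eps V W Ws w Vs v Q.
Arguments approximate_oblique_component_preserving_dual
  {R k H I} eps V W Ws w Vs v Q.

(* Main.v *)
Require Import Defs.
From mathcomp Require Import all_boot all_order all_algebra.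
From mathcomp Require Import finmap ring lra.
From mathcomp Require Import all_classical all_reals.
From mathcomp Require Import ereal topology normedtype esum.
From mathcomp Require summability.
Import Defs.

Set Implicit Arguments.
Unset Strict Implicit.
Unset Printing Implicit Defensive.

Import Order.TTheory GRing.Theory Num.Theory.
Import numFieldNormedType.Exports.

Local Open Scope classical_set_scope.
Local Open Scope ring_scope.

Local Notation partial_sum := summability.partial_sum.
Local Notation totally := summability.totally.

(** The operator L sends the family f to the sum of the L (component i f), since
    the partial sums of the components converge to f and L is continuous. As
    v_i (Q f)_i = L (component i f), this says that L factors as the synthesis
    operator of (Vs, v) composed with Q ([synthesis_factor]). The estimate of the
    oblique duality is then literally the one assumed on L, and Q preserves
    components because the i-th component of Q f only depends on that of f, while
    the i-th space of Vs is by definition what L makes of the i-th components.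

    What remains is that the Bessel sequence (Vs, v) has a lower frame bound. The
    range of L is V, so by the factorization every y in V is a sum of some
    v_i h_i with h in the Hilbert sum of the Vs. Let G be the set of the g in V
    whose frame sum is at most 1. For g in G, moving the projection on Vs i from
    h_i to g gives |<h_i, v_i g>| <= (|h_i|^2 + |v_i pi_i g|^2) / 2, and summing
    over i bounds |<y, g>| by (|h|^2 + 1) / 2, a number that depends on y only.
    So G is weakly bounded, hence bounded in norm by some M
    ([weakly_bounded_norm_bounded]), and since the frame sum is homogeneous of
    degree 2 this is a lower frame bound ([surjective_synthesis_lower_bound]).
    Working with G instead of preimages of bounded norm under L avoids an open
    mapping theorem, and with it the completeness of the Hilbert sum.

    The tools from Hilbert space theory are proved for real and complex scalars
    alike: the projection theorem for closed subspaces, and the uniform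
    boundedness principle for functionals <_, g>, by a gliding hump. *)

(** * Real-valued norms *)

Section RealNorm.
Context {R : realType} {k : scalar_kind}.
Local Notation K := (scalars R k).

Lemma sre_normD (a b : K) : sre `|a + b| <= sre `|a| + sre `|b|.
Proof. by rewrite -raddfD; apply/sre_le/ler_normD. Qed.

Lemma sre_norm_sum (J : Type) (s : seq J) (F : J -> K) :
  sre `|\sum_(i <- s) F i| <= \sum_(i <- s) sre `|F i|.
Proof. by rewrite -raddf_sum; exact/sre_le/ler_norm_sum. Qed.

Lemma sre_normM (a b : K) : sre `|a * b| = sre `|a| * sre `|b|.
Proof. by rewrite normrM -[ `|a|]sreK// sreM_sreal srealK. Qed.

Lemma sre_norm_sreal (a : R) : sre `|sreal k a| = `|a|.
Proof. by rewrite norm_sreal srealK. Qed.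

Context {E : normedModType K}.
Implicit Types x y : E.

Lemma sreal_rnorm x : sreal k (rnorm x) = `|x|.
Proof. by rewrite /rnorm sreK. Qed.

Lemma rnorm_ge0 x : 0 <= rnorm x.
Proof. exact/sre_ge0/normr_ge0. Qed.

Lemma rnorm0 : rnorm (0 : E) = 0.
Proof. by rewrite /rnorm normr0 raddf0. Qed.

Lemma rnorm_gt0 x : (0 < rnorm x) = (x != 0).
Proof. by rewrite -(@ltr_sreal R k) rmorph0 sreal_rnorm normr_gt0. Qed.

Lemma rnormN x : rnorm (- x) = rnorm x.
Proof. by rewrite /rnorm normrN. Qed.

Lemma rnormB x y : rnorm (x - y) = rnorm (y - x).
Proof. by rewrite /rnorm distrC. Qed.

Lemma ler_rnormD x y : rnorm (x + y) <= rnorm x + rnorm y.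
Proof. by rewrite /rnorm -raddfD; apply/sre_le/ler_normD. Qed.

Lemma rnormZ (a : K) x : rnorm (a *: x) = sre `|a| * rnorm x.
Proof. by rewrite /rnorm normrZ -[ `|a|]sreK// sreM_sreal srealK. Qed.

Lemma rnormZ_sreal (a : R) x : rnorm (sreal k a *: x) = `|a| * rnorm x.
Proof. by rewrite rnormZ sre_norm_sreal. Qed.

Lemma cvg_rnormP {T : Type} {F : set_system T} {FF : Filter F} (f : T -> E) l :
  f @ F --> l <->
  (forall e : R, 0 < e -> \forall t \near F, rnorm (l - f t) <= e).
Proof.
split=> [/cvgrPdist_le fl e e0|fl].
  have e0' : 0 < sreal k e by rewrite -(rmorph0 (@sreal R k)) ltr_sreal.
  by apply: filterS (fl _ e0') => t; rewrite -sreal_rnorm ler_sreal.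
apply/cvgrPdist_le => e e0.
have e0' : 0 < sre e by rewrite -(@ltr_sreal R k) rmorph0 sreK// ltW.
apply: filterS (fl _ e0') => t.
by move=> lt; rewrite -sreal_rnorm -(sreK (ltW e0)) ler_sreal.
Qed.

End RealNorm.

(** * Cauchy sequences with a given rate *)

Lemma harmonic_small (R : realType) (C e : R) : 0 < C -> 0 < e ->
  exists n : nat, C * n.+1%:R^-1 <= e.
Proof.
move=> C0 e0; exists (Num.truncn (C / e)).
rewrite ler_pdivrMr ?ltr0n// mulrC -ler_pdivrMr//.
exact/ltW/truncnS_gt.
Qed.

(** Completeness in the form in which both constructions below use it: a rate
    of convergence is known before the limit is, and passes to the limit. *)
Lemma cauchy_rate_cvg (R : realType) (k : scalar_kind)
    (E : completeNormedModType (scalars R k)) (u : nat -> E) (b : nat -> R) :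
  (forall e, 0 < e -> exists n, b n <= e) ->
  (forall n m, (n <= m)%N -> rnorm (u n - u m) <= b n) ->
  exists2 l, u @ \oo --> l & forall n, rnorm (u n - l) <= b n.
Proof.
move=> b_small ub.
have cu : cvg (u @ \oo).
  suff : cauchy (u @ \oo) by exact: cauchy_cvg.
  apply: cauchy_exP => e e0.
  have e0' : 0 < sre e by rewrite -(@ltr_sreal R k) rmorph0 sreK// ltW.
  have /b_small[N bN] : 0 < sre e / 2 by rewrite divr_gt0.
  exists (u N); exists N => // n /= Nn.
  rewrite -ball_normE /ball_ /= -sreal_rnorm -(sreK (ltW e0)) ltr_sreal.
  rewrite (le_lt_trans (ub _ _ Nn))// (le_lt_trans bN)//.
  by rewrite ltr_pdivrMr// ltr_pMr// ltr1n.
exists (lim (u @ \oo)) => // n.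
apply/ler_addgt0Pr => e e0.
have /cvg_rnormP/(_ e e0)[N _ uN] := cu.
rewrite -(subrKA (u (maxn n N))); apply: (le_trans (ler_rnormD _ _)).
apply: lerD; first by apply: ub; exact: leq_maxl.
by rewrite rnormB; apply: uN; exact: leq_maxr.
Qed.

(** * Inner products *)

Section InnerProduct.
Context {R : realType} {k : scalar_kind} {H : hilbertType R k}.
Local Notation K := (scalars R k).
Implicit Types x y g : H.

Lemma norm_inner_le x y : sre `|inner x y| <= rnorm x * rnorm y.
Proof. by rewrite !rnorm_dotnorm; exact: CauchySchwarz_dotnorm. Qed.

Lemma inner_rnorm_sqr x : inner x x = sreal k (rnorm x ^+ 2).
Proof. by rewrite rmorphXn/= sreal_rnorm inner_norm. Qed.

Lemma rnormD_sqr x y :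
  rnorm (x + y) ^+ 2 = rnorm x ^+ 2 + sre (inner x y) *+ 2 + rnorm y ^+ 2.
Proof.
rewrite !rnorm_sqrE formDl !formDr (formC _ y x) addrA -[_ + _ + sconj _]addrA.
by rewrite sreal_sreD 2!raddfD/= srealK.
Qed.

Lemma parallelogram x y :
  rnorm (x + y) ^+ 2 + rnorm (x - y) ^+ 2 =
  (rnorm x ^+ 2 + rnorm y ^+ 2) *+ 2.
Proof. rewrite !rnormD_sqr rnormN formNr raddfN/=; ring. Qed.

Lemma norm_inner_le_lim {T : Type} {F : set_system T} {FF : ProperFilter F}
    (f : T -> H) y g (C : R) : f @ F --> y ->
  (forall t, sre `|inner (f t) g| <= C) -> sre `|inner y g| <= C.
Proof.
move=> /cvg_rnormP fy fC; apply/ler_addgt0Pr => e e0.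
have g1 : 0 < rnorm g + 1 by rewrite ltr_wpDl// rnorm_ge0.
have /fy/filter_ex[t yt] : 0 < e / (rnorm g + 1) by rewrite divr_gt0.
rewrite -[y](subrK (f t)) formDl (le_trans (sre_normD _ _))// addrC lerD//.
rewrite (le_trans (norm_inner_le _ _))//.
rewrite (@le_trans _ _ (e / (rnorm g + 1) * (rnorm g + 1)))//.
  by rewrite ler_pM ?rnorm_ge0// lerDl.
by rewrite divfK// gt_eqF.
Qed.

(** * Orthogonal projections on closed subspaces *)

Lemma subspaceZ (S : closedSubspace H) (a : K) x :
  subspace_set S x -> subspace_set S (a *: x).
Proof. by move=> Sx; rewrite -[_ *: _]addr0; exact/subspaceP/subspace0. Qed.

Lemma subspaceB (S : closedSubspace H) x y :
  subspace_set S x -> subspace_set S y -> subspace_set S (x - y).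
Proof. by move=> Sx Sy; rewrite addrC -scaleN1r; exact: subspaceP. Qed.

(** By the parallelogram law, two points of S whose squared distances to f are
    within h ^ 2 of the infimum d are at distance at most 2 h from each other,
    as their midpoint is not closer to f than d allows. *)
Lemma nearest_point (S : closedSubspace H) f :
  exists2 s, subspace_set S s &
    forall t, subspace_set S t -> rnorm (f - s) <= rnorm (f - t).
Proof.
pose D := [set rnorm (f - t) ^+ 2 | t in subspace_set S].
have D0 : lbound D 0 by move=> _ [t _ <-]; exact: sqr_ge0.
have iD : has_inf D.
  split; last by exists 0.
  by exists (rnorm (f - 0) ^+ 2); exists 0 => //; exact: subspace0.
pose d := inf D.
have dle t : subspace_set S t -> d <= rnorm (f - t) ^+ 2.
  by move=> St; apply: ge_inf; [exists 0|exists t].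
have d0 : 0 <= d by apply: lb_le_inf; [case: iD|exact: D0].
pose h n : R := n.+1%:R^-1.
have h0 n : 0 < h n by rewrite invr_gt0.
have near_inf n :
    exists t, subspace_set S t /\ rnorm (f - t) ^+ 2 <= d + h n ^+ 2.
  have [_ [t St <-] /ltW td] := inf_adherent (exprn_gt0 2 (h0 n)) iD.
  by exists t.
have [u uP] := choice near_inf.
have Su n : subspace_set S (u n) by have [] := uP n.
have ud n : rnorm (f - u n) ^+ 2 <= d + h n ^+ 2 by have [] := uP n.
have [||s us sb] := @cauchy_rate_cvg _ _ _ u (fun n => 2 * h n).
- by move=> e e0; exact: harmonic_small.
- move=> n m nm.
  have hmn : h m <= h n by rewrite lef_pV2 ?posrE ?ltr0n// ler_nat ltnS.
  rewrite -(@ler_pXn2r _ 2) ?nnegrE ?rnorm_ge0 ?mulr_ge0 ?(ltW (h0 _))//.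
  have := parallelogram (f - u m) (f - u n).
  rewrite (_ : f - u m - (f - u n) = u n - u m); last first.
    by rewrite opprB addrC addrA subrK.
  (* The midpoint of u m and u n. *)
  pose c := sreal k 2^-1 *: u m + sreal k 2^-1 *: u n.
  have Sc : subspace_set S c by apply: subspaceP => //; exact: subspaceZ.
  rewrite (_ : f - u m + (f - u n) = sreal k 2 *: (f - c)); last first.
    rewrite scalerBr scalerDr !scalerA -rmorphM/= divff// rmorph1 !scale1r.
    by rewrite -[2]/(1 *+ 2) rmorphMn rmorph1 scaler_nat mulr2n opprD addrACA.
  rewrite rnormZ_sreal.
  have := dle _ Sc; have := ud n; have := ud m.
  have hm2 : h m ^+ 2 <= h n ^+ 2 by rewrite ler_pXn2r ?nnegrE ?(ltW (h0 _)).
  rewrite exprMn ger0_norm// exprMn; move: hm2.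
  move: (rnorm _ ^+ 2) (rnorm _ ^+ 2) (rnorm _ ^+ 2) (rnorm _ ^+ 2) => *.
  by lra.
exists s.
  apply: (closed_cvg (subspace_set S) (@subspace_closed _ _ _ S)) us.
  exact: nearW.
move=> t St; apply/ler_addgt0Pr => e e0.
apply: (@le_trans _ _ (Num.sqrt d + e)); last first.
  rewrite lerD2r -[leRHS](ger0_norm (rnorm_ge0 _)) -sqrtr_sqr ler_wsqrtr//.
  exact: dle.
(* u n is at distance at most sqrt d + h n from f, and at most 2 h n from s. *)
have [n hn] : exists n, 3 * h n <= e by exact: harmonic_small.
apply: le_trans (lerD (lexx _) hn).
rewrite -(subrKA (u n)) (le_trans (ler_rnormD _ _))//.
have : rnorm (f - u n) <= Num.sqrt d + h n.
  rewrite -(@ler_pXn2r _ 2) ?nnegrE ?rnorm_ge0 ?addr_ge0 ?sqrtr_ge0//;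
    last by rewrite ltW.
  rewrite sqrrD sqr_sqrtr// (le_trans (ud n))//.
  by rewrite lerD2r lerDl mulrn_wge0// mulr_ge0 ?sqrtr_ge0// ltW.
have := sb n; lra.
Qed.

(** The nearest point s is the projection: if z = <f - s, t> were nonzero for some
    t in S, then moving s by a z t with a small real a > 0 would decrease the
    squared distance to f by a |z|^2 (2 - a |t|^2). *)
Lemma orthogonal_projectionP (S : closedSubspace H) f :
  subspace_set S (orthogonal_projection S f) /\
  orthogonal_complement S (f - orthogonal_projection S f).
Proof.
rewrite /orthogonal_projection /oblique_projection; case: xgetP => [s _ //|].
have [s Ss smin] := nearest_point S f; move=> /(_ s) []; split=> // t St.
apply/eqP/negPn/negP => z0.
set p := f - s; set z := inner p t.
pose a : R := (rnorm t ^+ 2 + 1)^-1.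
have t1 : 0 < rnorm t ^+ 2 + 1 by rewrite ltr_wpDl ?sqr_ge0.
have a0 : 0 < a by rewrite invr_gt0.
have nz : 0 < sre `|z| ^+ 2.
  by rewrite exprn_gt0// -(@ltr_sreal R k) rmorph0 sreK// normr_gt0.
have := smin _ (subspaceP (sreal k a * z) St Ss).
rewrite opprD addrCA [- _ + _]addrC -/p.
rewrite -(@ler_pXn2r _ 2) ?nnegrE ?rnorm_ge0// [leRHS]rnormD_sqr rnormN rnormZ.
rewrite formNr formZr rmorphM/= sconj_sreal -mulrA.
rewrite [sconj z * _]mulrC -/z mul_sconj.
rewrite -[ `|z| ^+ 2]sreK ?exprn_ge0// -rmorphM/= raddfN/= srealK.
rewrite sre_normM sre_norm_sreal (gtr0_norm a0).
have -> : sre (`|z| ^+ 2) = sre `|z| ^+ 2.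
  by rewrite -[in LHS](sreK (normr_ge0 z)) -rmorphXn/= srealK.
apply/negP; rewrite -ltNge.
rewrite -addrA gtrDl !exprMn.
rewrite (_ : _ + _ = - (a * sre `|z| ^+ 2 * (2 - a * rnorm t ^+ 2))); last ring.
rewrite oppr_lt0; apply: mulr_gt0; first exact: mulr_gt0.
rewrite subr_gt0; have : a * (rnorm t ^+ 2 + 1) = 1 by rewrite mulVf// gt_eqF.
rewrite mulrDr mulr1; lra.
Qed.

Lemma orthogonal_projection_unique (S : closedSubspace H) f s :
  subspace_set S s -> orthogonal_complement S (f - s) ->
  orthogonal_projection S f = s.
Proof.
have [Sp fp] := orthogonal_projectionP S f; set p := orthogonal_projection S f.
move=> Ss fs; have Sd : subspace_set S (s - p) by exact: subspaceB.
have /eqP : `|s - p| ^+ 2 = 0.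
  rewrite -inner_norm {1}(_ : s - p = (f - p) - (f - s)).
    by rewrite formDl formNl fp// fs// subrr.
  by rewrite opprB [RHS]addrC subrKA.
by rewrite expf_eq0/= normr_eq0 subr_eq0 => /eqP.
Qed.

Lemma orthogonal_projectionZ (S : closedSubspace H) (a : K) f :
  orthogonal_projection S (a *: f) = a *: orthogonal_projection S f.
Proof.
have [Sp fp] := orthogonal_projectionP S f.
apply: orthogonal_projection_unique; first exact: subspaceZ.
by move=> t St; rewrite -scalerBr formZl fp// mulr0.
Qed.

Lemma inner_projection (S : closedSubspace H) x f : subspace_set S x ->
  inner x f = inner x (orthogonal_projection S f).
Proof.
move=> Sx; have [_ fp] := orthogonal_projectionP S f.
rewrite -[in LHS](subrK (orthogonal_projection S f) f) formDr.
by rewrite [X in X + _]formC fp// rmorph0 add0r.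
Qed.

(** * Uniform boundedness *)

(** The values of <_, g> at x + u and x - u, where u is the multiple of g of
    norm r, differ by 2 r |g|, so one of them has modulus at least r |g|. *)
Lemma large_inner_nearby x g (r : R) : 0 <= r -> g != 0 ->
  exists y, rnorm (x - y) <= r /\ r * rnorm g <= sre `|inner y g|.
Proof.
move=> r0 g0; have ng : 0 < rnorm g by rewrite rnorm_gt0.
pose u := sreal k (r / rnorm g) *: g.
have nu : rnorm u = r.
  by rewrite rnormZ_sreal ger0_norm ?divr_ge0 ?rnorm_ge0// divfK// gt_eqF.
have ug : inner u g = sreal k (r * rnorm g).
  rewrite formZl inner_rnorm_sqr -rmorphM/=; congr sreal.
  by rewrite expr2 mulrA divfK// gt_eqF.
case: (leP (r * rnorm g) (sre `|inner (x + u) g|)) => [h|h].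
  by exists (x + u); split=> //; rewrite opprD addNKr rnormN nu.
exists (x - u); split; first by rewrite opprB addrC addrNK nu.
have := sre_normD (inner (x + u) g) (- inner (x - u) g).
rewrite normrN formDl [inner (x - u) g]formDl formNl.
rewrite opprD opprK addrACA subrr add0r -[inner u g + _]mulr2n ug.
rewrite -rmorphMn/= sre_norm_sreal ger0_norm; last first.
  by rewrite mulrn_wge0// mulr_ge0// rnorm_ge0.
rewrite -ug -formDl -formNl -formDl.
by move: h; lra.
Qed.

(** The uniform boundedness principle for the functionals <_, g>, by a gliding hump
    rather than a Baire category argument. If G were unbounded, take g n in G of
    norm larger than 2 n 3^n and move step by step, by at most 3^-n at the step
    n, to a point where the modulus of <_, g n> is at least 3^-n |g n|. The later
    steps have total length 3^-n / 2 at most, so that the limit y still satisfies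
    |<y, g n>| >= 3^-n |g n| / 2 > n. *)
Lemma weakly_bounded_norm_bounded (G : set H) :
  (forall x, exists M : R, forall g, G g -> sre `|inner x g| <= M) ->
  exists M : R, forall g, G g -> rnorm g <= M.
Proof.
move=> wG; apply: contrapT => nG.
have big (M : R) : exists g, G g /\ M < rnorm g.
  apply: contrapT => nM; apply: nG; exists M => g Gg.
  by rewrite leNgt; apply/negP => Mg; apply: nM; exists g.
pose r n : R := 3 ^- n.
have r0 n : 0 < r n by rewrite invr_gt0 exprn_gt0.
have rS n : r n.+1 = r n / 3 by rewrite /r exprS invfM mulrC.
have [g gP] := choice (fun n => big (2 * n%:R / r n)).
have Gg n : G (g n) by have [] := gP n.
have ng n : 2 * n%:R / r n < rnorm (g n) by have [] := gP n.
have g0 n : g n != 0.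
  rewrite -rnorm_gt0; apply: le_lt_trans (ng n).
  by rewrite divr_ge0 ?mulr_ge0 ?ler0n ?(ltW (r0 _)).
have [nxt nxtP] := choice (fun p : nat * H =>
  large_inner_nearby p.2 (ltW (r0 p.1)) (g0 p.1)).
pose fix x n : H := if n is n'.+1 then nxt (n', x n') else 0.
have x_step n : rnorm (x n - x n.+1) <= r n by have [] := nxtP (n, x n).
have x_big n : r n * rnorm (g n) <= sre `|inner (x n.+1) (g n)|.
  by have [] := nxtP (n, x n).
(* 3^-n + 3^-(n+1) + 3^-(n+2) + ... = 3 / 2 * 3^-n. *)
have [||y _ yx] := @cauchy_rate_cvg _ _ _ x (fun n => 3 / 2 * r n).
- move=> e e0; have [|n hn] := @harmonic_small _ (3 / 2) e _ e0.
    by rewrite divr_gt0.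
  exists n; apply: le_trans hn; rewrite ler_pM2l ?divr_gt0//.
  rewrite lef_pV2 ?posrE ?exprn_gt0//.
  by rewrite -natrX ler_nat ltn_expl.
- move=> n m nm; rewrite -(subnK nm); move: (m - n)%N => {m nm} d.
  elim: d n => [|d IH] n.
    by rewrite add0n subrr rnorm0 mulr_ge0 ?divr_ge0 ?(ltW (r0 _)).
  rewrite -(subrKA (x n.+1)) (le_trans (ler_rnormD _ _))//.
  rewrite addSnnS; have := IH n.+1; have := x_step n; rewrite rS; lra.
have [M yM] := wG y.
pose n := (Num.truncn M).+1.
have Mn : M < n%:R by exact: truncnS_gt.
have := yM _ (Gg n).
have := sre_normD (inner (x n.+1 - y) (g n)) (inner y (g n)).
rewrite -formDl subrK.
have := le_trans (norm_inner_le _ _) (ler_wpM2r (rnorm_ge0 (g n)) (yx n.+1)).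
have := x_big n; have := ng n; rewrite ltr_pdivrMr// rS.
move: (sre _) (sre _) (sre _) => *; nra.
Qed.

End InnerProduct.

(** * Hilbert sums *)

Section HilbertSum.
Context {R : realType} {k : scalar_kind} {H : hilbertType R k} {I : choiceType}.
Local Notation K := (scalars R k).

Lemma esum_le_partial_sumP (a : I -> R) (C : R) :
  (\esum_(i in [set: I]) (a i)%:E <= C%:E)%E <->
  forall A : {fset I}, partial_sum a A <= C.
Proof.
split=> [aC A|aC]; last first.
  apply: ge_ereal_sup => _ [A [finA _] <-].
  by rewrite -(fset_setK finA) fsbig_partial_sum lee_fin.
rewrite -lee_fin -fsbig_partial_sum; apply: le_trans aC.
by apply: ereal_sup_ubound; exists [set` A].
Qed.

Variable S : I -> closedSubspace H.
Implicit Types f : hilbert_sum S.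

Lemma rnorm_hilbert_sum_leP f (C : R) :
  rnorm f ^+ 2 <= C <->
  forall A, partial_sum (fun i => rnorm (f i) ^+ 2) A <= C.
Proof. by rewrite -lee_fin rnorm_hilbert_sum; exact: esum_le_partial_sumP. Qed.

Lemma partial_sum_componentE f (A : {fset I}) i :
  partial_sum (fun j => component j f) A i = if i \in A then f i else 0.
Proof.
rewrite partial_sumE.
rewrite (big_morph (fun g : hilbert_sum S => g i) (id1 := 0) (op1 := +%R))//=.
case: ifPn => [iA|iA].
  rewrite (big_fsetD1 i)//= eqxx big1_fset ?addr0// => j.
  by rewrite !inE eq_sym => /andP[/negPf->].
by rewrite big1_fset// => j jA _; case: eqP => // ij; rewrite ij jA in iA.
Qed.

(** The squared norm of f minus a partial sum over A is the tail of the series of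
    the |f i|^2 outside A; a finite part B of this tail is bounded by what the
    sum over the union of A and B adds to the sum over A. *)
Lemma component_cvg f :
  partial_sum (fun j => component j f) @ totally --> f.
Proof.
apply/cvg_rnormP => e e0.
pose a i := rnorm (f i) ^+ 2.
have a0 i : 0 <= a i by exact: sqr_ge0.
have af : forall A, partial_sum a A <= rnorm f ^+ 2.
  exact: (rnorm_hilbert_sum_leP f _).1.
have := cvg_partial_sum_ge0 a0 af; set s := sup _ => as_.
have as_le A : partial_sum a A <= s.
  apply: ub_le_sup; last by exists A.
  by exists (rnorm f ^+ 2) => _ [B _ <-].
have /cvgrPdist_le/(_ _ (exprn_gt0 2 e0)) := as_.
apply: filterS => A sA.
rewrite -(@ler_pXn2r _ 2) ?nnegrE ?rnorm_ge0 ?(ltW e0)//.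
apply/rnorm_hilbert_sum_leP => B; apply: le_trans sA.
rewrite ger0_norm ?subr_ge0// lerBrDl; apply: le_trans (as_le (A `|` B)%fset).
set g := f - _; have gE i : rnorm (g i) ^+ 2 = if i \in A then 0 else a i.
  rewrite /g -[(f - _) i]/(f i - partial_sum (fun j => component j f) A i)
          partial_sum_componentE.
  by case: ifP => _; rewrite ?subr0// subrr rnorm0 expr0n.
have : partial_sum (fun i => rnorm (g i) ^+ 2) B <=
    partial_sum (fun i => rnorm (g i) ^+ 2) (A `|` B)%fset.
  by apply: le_partial_sum; [move=> i; exact: sqr_ge0|exact: fsubsetUr].
have -> : partial_sum a A =
    partial_sum (fun i => if i \in A then a i else 0) (A `|` B)%fset.
  rewrite !partial_sumE.
  transitivity (\sum_(i <- A) (if i \in A then a i else 0)).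
    by rewrite [LHS]big_seq [RHS]big_seq; apply: eq_bigr => i iA; rewrite ifT.
  by apply: big_fset_incl; [exact: fsubsetUl|move=> i _ /negPf ->].
rewrite -(lerD2l
  (partial_sum (fun i => if i \in A then a i else 0) (A `|` B)%fset)).
move=> /le_trans; apply; rewrite !partial_sumE -big_split/= ler_sum// => i _.
by rewrite gE; case: ifP; rewrite ?addr0 ?add0r.
Qed.

End HilbertSum.

(** * Lower frame bounds *)

Section FusionFrames.
Context {R : realType} {k : scalar_kind} {H : hilbertType R k} {I : countType}.
Local Notation K := (scalars R k).
Implicit Types (V : closedSubspace H) (Vs Ws : I -> closedSubspace H).
Implicit Types (v : I -> R) (f g : H).

Lemma frame_sumZ_le Vs v f (c r : R) :
  (frame_sum Vs v f <= r%:E)%E ->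
  (frame_sum Vs v (sreal k c *: f) <= (c ^+ 2 * r)%:E)%E.
Proof.
move=> /esum_le_partial_sumP fr; apply/esum_le_partial_sumP => A.
rewrite (le_trans _ (ler_wpM2l (sqr_ge0 c) (fr A)))// !partial_sumE mulr_sumr.
apply: ler_sum => i _.
rewrite orthogonal_projectionZ rnormZ_sreal exprMn real_normK ?num_real//.
by rewrite mulrCA.
Qed.

(** As h i lies in Vs i, only the projection of g on Vs i contributes to
    <v i h i, g>, and 2 |<x, y>| <= |x|^2 + |y|^2 applies term by term. The bound
    does not depend on A nor on g, which is what weak boundedness requires. *)
Lemma frame_pairing_le Vs v (h : hilbert_sum Vs) g (A : {fset I}) :
  (frame_sum Vs v g <= 1%:E)%E ->
  sre `|inner (partial_sum (fun i => sreal k (v i) *: h i) A) g| *+ 2 <=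
  rnorm h ^+ 2 + 1.
Proof.
move=> /esum_le_partial_sumP/(_ A) g1.
have /l2_familiesP[hS _] := family_ofP h.
have hA : partial_sum (fun i => rnorm (h i) ^+ 2) A <= rnorm h ^+ 2.
  exact: (rnorm_hilbert_sum_leP h _).1.
apply: le_trans (lerD hA g1); rewrite !partial_sumE -big_split/=.
rewrite (big_morph (fun x => inner x g) (id1 := 0) (op1 := +%R)); first last.
- exact: linear0l.
- by move=> x y; rewrite formDl.
rewrite (le_trans (ler_wMn2r 2 (sre_norm_sum _ _)))//.
rewrite -sumrMnl ler_sum// => i _.
rewrite formZl (inner_projection g (hS i)) -[sreal k _]sconj_sreal -formZr.
rewrite (le_trans (form_le_sum inner _ _))// -!rnorm_sqrE.
by rewrite rnormZ_sreal exprMn real_normK ?num_real.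
Qed.

(** The g in V with frame sum at most 1 are weakly bounded by [frame_pairing_le],
    hence bounded in norm, say by M. An f in V violating the lower bound
    1 / (M ^ 2 + 1) could be rescaled to one of them of squared norm M ^ 2 + 1.
    Surjectivity is stated through convergent partial sums because the value of
    [synthesis] alone does not record the convergence. *)
Lemma surjective_synthesis_lower_bound V Vs v :
  (forall y, subspace_set V y -> exists h : hilbert_sum Vs,
     partial_sum (fun i => sreal k (v i) *: h i) @ totally --> y) ->
  exists2 a : R, 0 < a & forall f, subspace_set V f ->
    ((a * rnorm f ^+ 2)%:E <= frame_sum Vs v f)%E.
Proof.
move=> surj.
(* Only the component of x in V matters for <x, g> with g in V. *)
have [|M GM] := @weakly_bounded_norm_bounded R k H
    [set g | subspace_set V g /\ (frame_sum Vs v g <= 1%:E)%E].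
  move=> x; have [Vp xp] := orthogonal_projectionP V x.
  have [h hp] := surj _ Vp.
  exists ((rnorm h ^+ 2 + 1) / 2) => g [Vg g1].
  rewrite -[x](subrK (orthogonal_projection V x)) formDl xp// add0r.
  apply: norm_inner_le_lim hp _ => A.
  by rewrite ler_pdivlMr// mulr_natr; exact: frame_pairing_le.
have M1 : 0 < M ^+ 2 + 1 by rewrite ltr_wpDl ?sqr_ge0.
exists (M ^+ 2 + 1)^-1; first by rewrite invr_gt0.
move=> f Vf; rewrite leNgt; apply/negP; set t := _ * _ => ft.
have t0 : 0 < t.
  rewrite -lte_fin; apply: le_lt_trans ft; apply: esum_ge0 => i _.
  by rewrite lee_fin mulr_ge0 ?sqr_ge0.
pose c := (Num.sqrt t)^-1.
have c2 : c ^+ 2 = t^-1 by rewrite exprVn sqr_sqrtr// ltW.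
have : rnorm (sreal k c *: f) <= M.
  apply: GM; split; first exact: subspaceZ.
  by apply: le_trans (frame_sumZ_le c (ltW ft)) _; rewrite c2 mulVf// gt_eqF.
have c0 : 0 <= c by rewrite invr_ge0 sqrtr_ge0.
move=> gM; have : rnorm (sreal k c *: f) ^+ 2 <= M ^+ 2.
  by rewrite ler_pXn2r ?nnegrE ?rnorm_ge0// (le_trans _ gM)// rnorm_ge0.
rewrite rnormZ_sreal exprMn ger0_norm// c2 ler_pdivrMl//.
have : t * (M ^+ 2 + 1) = rnorm f ^+ 2.
  by rewrite /t mulrAC mulVf ?mul1r// gt_eqF.
by move=> <-; rewrite ler_pM2l// leNgt ltrDl ltr01.
Qed.

(** * The factorization of L through Q *)

Lemma component_component Ws (h : hilbert_sum Ws) i j :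
  component i (component j h) = if i == j then component j h else 0.
Proof.
apply/val_inj/funext => l /=; have [->|ij] := eqVneq i j.
  by rewrite /=; case: eqP.
by rewrite /=; case: eqP => // ->; rewrite (negPf ij).
Qed.

Section Factorization.
Variables (Vs Ws : I -> closedSubspace H) (v : I -> R).
Variables (L : {linear hilbert_sum Ws -> H}).
Variables (Q : {linear hilbert_sum Ws -> hilbert_sum Vs}).
Hypothesis v0 : forall i, 0 < v i.
Hypothesis QL : forall h i, Q h i = sreal k (v i)^-1 *: L (component i h).

Lemma weighted_component h i : sreal k (v i) *: Q h i = L (component i h).
Proof. by rewrite QL scalerA -rmorphM/= divff ?rmorph1 ?scale1r// gt_eqF. Qed.

Lemma synthesis_factor_cvg h : bounded_operator L ->
  partial_sum (fun i => sreal k (v i) *: Q h i) @ totally --> L h.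
Proof.
move=> /bounded_linear_continuous Lc.
rewrite (_ : (fun i => _) = (fun i => L (component i h))); last first.
  by apply/funext => i; rewrite weighted_component.
rewrite (partial_sum_morph L).
by apply: continuous_cvg; [exact: Lc|exact: component_cvg].
Qed.

Lemma synthesis_factor : bounded_operator L -> synthesis Vs v \o Q = L.
Proof.
move=> Lb; apply/funext => h; apply: cvg_lim; first exact: norm_hausdorff.
exact: synthesis_factor_cvg.
Qed.

(** A family g concentrated on j is reached because v j g j is in Vs j, hence of
    the form L (component j f), and Q divides it by v j again. *)
Lemma factor_component_preserving :
  (forall i, Vs i = [set L (component i h) | h in setT] :> set H) ->
  component_preserving Q.
Proof.
move=> VL j; apply/seteqP; split=> _ [h _ <-].
  exists (Q h) => //; apply/val_inj/funext => i /=.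
  rewrite !QL component_component; case: eqP => [->|_]; first by [].
  by rewrite linear0 scaler0.
have /l2_familiesP[hS _] := family_ofP h.
have : subspace_set (Vs j) (sreal k (v j) *: h j) by exact: subspaceZ.
rewrite -[subspace_set _ _]/((Vs j : set H) _) VL => -[f _ fh].
exists f => //; apply/val_inj/funext => i /=.
rewrite QL component_component; case: eqP => [->|_].
  by rewrite fh scalerA -rmorphM/= mulVf ?rmorph1 ?scale1r// gt_eqF.
by rewrite linear0 scaler0.
Qed.

End Factorization.
End FusionFrames.

Theorem lemma4p2 (R : realType) (k : scalar_kind) (H : hilbertType R k)
    (I : countType) (V W : closedSubspace H) (Vs Ws : I -> closedSubspace H)
    (v w : I -> R) (eps : R) (L : {linear hilbert_sum Ws -> H})
    (Q : {linear hilbert_sum Ws -> hilbert_sum Vs}) :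
  separable_space H ->
  direct_sum V (orthogonal_complement W) ->
  0 <= eps ->
  fusion_frame W Ws w ->
  approximate_left_inverses (adjoint (synthesis Ws w)) eps
    V (orthogonal_complement W) L ->
  (forall i, Vs i = [set L (component i f) | f in setT] :> set H) ->
  fusion_bessel V Vs v ->
  bounded_operator Q ->
  (forall f i, Q f i = sreal k (v i)^-1 *: L (component i f)) ->
  approximate_oblique_component_preserving_dual eps V W Ws w Vs v Q.
Proof.
move=> _ _ _ _ [Leps Lb LV] VL [VsV wv [beta beta0 Vbeta]] Qb QL.
have v0 i : 0 < v i by case: wv.
split; last exact: factor_component_preserving v0 QL VL.
split=> //; last by rewrite (synthesis_factor v0 QL Lb).
split=> //.
have [|a a0 Va] := @surjective_synthesis_lower_bound R k H I V Vs v.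
  move=> y; rewrite -[subspace_set V _]/((V : set H) _) -LV => -[h _ <-].
  by exists (Q h); exact: synthesis_factor_cvg.
exists (Num.min a beta), beta; split=> [||f Vf].
- by rewrite lt_min a0.
- by rewrite ge_min lexx orbT.
rewrite Vbeta// andbT; apply: le_trans (Va f Vf).
by rewrite lee_fin ler_wpM2r ?sqr_ge0// ge_min lexx.
Qed.
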